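(* Let $(B,+,\cdot)$ be a finite skew brace, let $K$, $C$, $D$ be the subgroups of the associated trifactorised group $G = KC = KD = DC$ as defined in the context, and let $\pi$ be a set of primes. Assume that each of the groups $G$, $D$ and $C$ satisfies the $\pi$-Sylow theorem. Let $G_\pi$ be a Hall $\pi$-subgroup of $G$ and let $K_\pi = G_\pi\cap K$, $D_\pi$, $C_\pi$ be Hall $\pi$-subgroups of $K$, $D$, $C$, respectively, such that $G_\pi = K_\pi C_\pi = K_\pi D_\pi = D_\pi C_\pi$ (at least one such choice exists). Then $C_\pi$ acts on $K_\pi$ by the restriction of the lambda action, and $D_\pi$ is the diagonal subgroup associated to $K_\pi$ and $C_\pi$; that is, identifying $K$ and $C$ with $B$ as sets, $K_\pi$ and $C_\pi$ are the same subset of $B$ and $D_\pi=\{(b,b) : b\in K_\pi\}$. Consequently, $(K_\pi,+,\cdot)$ is a subbrace of $(B,+,\cdot)$.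
   Context: All groups are finite. A skew (left) brace $(B,+,\cdot)$ is a set $B$ with two group structures $(B,+)$ (not necessarily abelian) and $(B,\cdot)$ such that $a\cdot(b+c) = a\cdot b - a + a\cdot c$ for all $a,b,c\in B$. A subbrace is a subset of $B$ that is a subgroup of both $(B,+)$ and $(B,\cdot)$. The lambda action is the action of $(B,\cdot)$ on $(B,+)$ by automorphisms given by $\lambda_a(b) = -a + a\cdot b$. The associated trifactorised group is the semidirect product $G$ of $(B,+)$ by $(B,\cdot)$ with respect to $\lambda$: its elements are the pairs $(x,a)\in B\times B$, with product $(x,a)(y,b) = (x+\lambda_a(y),\, a\cdot b)$. Let $0$ be the common identity element of $(B,+)$ and $(B,\cdot)$. Put $K=\{(x,0): x\in B\}$ (identified with $(B,+)$, and normal in $G$), $C=\{(0,a): a\in B\}$ (identified with $(B,\cdot)$), and $D=\{(b,b): b\in B\}$ (the diagonal subgroup). These are subgroups of $G$ with $G=KC=KD=DC$. For a set of primes $\pi$, a $\pi$-subgroup is a subgroup all of whose order's prime divisors lie in $\pi$; a Hall $\pi$-subgroup of a finite group is a $\pi$-subgroup whose index is divisible by no prime in $\pi$. A finite group $X$ is said to satisfy the $\pi$-Sylow theorem (property $D_\pi$) if every $\pi$-subgroup of $X$ is contained in a Hall $\pi$-subgroup of $X$ and any two Hall $\pi$-subgroups of $X$ are conjugate in $X$. *)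

(* Defs.v *)
From HB Require Import structures.
From mathcomp Require Import all_boot all_fingroup pgroup.

Set Implicit Arguments.
Unset Strict Implicit.
Unset Printing Implicit Defensive.

Import GroupScope.

Declare Scope brace_scope.
Delimit Scope brace_scope with brace.

(* The multiplicative group (B, .) is the finGroupType structure of B; the    *)
(* additive group, not necessarily abelian, is given by the fields below.     *)
HB.mixin Record FinGroup_isSkewBrace B of FinGroup B := {
  badd : B -> B -> B;
  bopp : B -> B;
  bzero : B;
  baddA : associative badd;
  badd0b : left_id bzero badd;
  baddNb : left_inverse bzero bopp badd;
  bmulD : forall a b c : B,
    a * badd b c = badd (badd (a * b) (bopp a)) (a * c)
}.

#[short(type="finSkewBraceType")]
HB.structure Definition FinSkewBrace :=
  {B of FinGroup_isSkewBrace B & FinGroup B}.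

Notation "0" := (@bzero _) : brace_scope.
Notation "x + y" := (badd x y) : brace_scope.
Notation "- x" := (bopp x) : brace_scope.

(* The set B with its additive group as the finGroupType structure. *)
Definition addgroup (B : finSkewBraceType) : Type := B.

HB.instance Definition _ (B : finSkewBraceType) := Finite.on (addgroup B).
HB.instance Definition _ (B : finSkewBraceType) :=
  Finite_isGroup.Build (addgroup B) (@baddA B) (@badd0b B) (@baddNb B).

Lemma badd_mulg (B : finSkewBraceType) (x y : B) :
  (x + y)%brace = (x : addgroup B) * (y : addgroup B) :> addgroup B.
Proof. by []. Qed.

Lemma bopp_invg (B : finSkewBraceType) (x : B) :
  (- x)%brace = (x : addgroup B)^-1 :> addgroup B.
Proof. by []. Qed.

Lemma bzero_one (B : finSkewBraceType) : 0%brace = 1 :> addgroup B.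
Proof. by []. Qed.

Lemma mulb0 (B : finSkewBraceType) (a : B) : a * 0%brace = a.
Proof.
have := bmulD a 0%brace 0%brace; rewrite badd0b.
move/(congr1 (mul (- (a * 0) : addgroup B)%brace)).
rewrite !badd_mulg !bopp_invg mulVg -!mulgA mulKg.
by move/(congr1 (mul (a : addgroup B))); rewrite mulKVg mulg1.
Qed.

(* 0 is also the identity of (B, .). *)
Lemma bzeroE (B : finSkewBraceType) : 0%brace = 1 :> B.
Proof. by rewrite -[LHS]mul1g mulb0. Qed.

Definition lambda (B : finSkewBraceType) (a b : B) : B := (- a + a * b)%brace.

Lemma lambdaD (B : finSkewBraceType) (a : B) :
  {morph lambda a : x y / (x + y)%brace}.
Proof.
by move=> x y; rewrite /lambda bmulD !badd_mulg !bopp_invg !mulgA.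
Qed.

Lemma lambda0 (B : finSkewBraceType) (a : B) : lambda a 0%brace = 0%brace.
Proof. by rewrite /lambda mulb0 baddNb. Qed.

Lemma lambda1 (B : finSkewBraceType) (x : B) : lambda 1 x = x.
Proof.
by rewrite /lambda mul1g -bzeroE badd_mulg bopp_invg invg1 mul1g.
Qed.

Lemma lambdaM (B : finSkewBraceType) (a b x : B) :
  lambda (a * b) x = lambda a (lambda b x).
Proof.
have H : (lambda a b + lambda (a * b) x = lambda a b + lambda a (lambda b x))%brace.
  rewrite -lambdaD /lambda !badd_mulg !bopp_invg mulKVg.
  by rewrite -!mulgA !mulKVg mulgA.
by move/(congr1 (mul (lambda a b : addgroup B)^-1)): H; rewrite !badd_mulg !mulKg.
Qed.

(* The semidirect product of (B, +) by (B, .) with respect to lambda. *)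
Definition trifact (B : finSkewBraceType) : Type := (B * B)%type.

HB.instance Definition _ (B : finSkewBraceType) := Finite.on (trifact B).

Definition trifact_mul (B : finSkewBraceType) (u v : trifact B) : trifact B :=
  ((u.1 + lambda u.2 v.1)%brace, u.2 * v.2).

Definition trifact_one (B : finSkewBraceType) : trifact B :=
  (0%brace, 0%brace).

Definition trifact_inv (B : finSkewBraceType) (u : trifact B) : trifact B :=
  (lambda u.2^-1 (- u.1)%brace, u.2^-1).

Lemma trifact_mulA (B : finSkewBraceType) : associative (@trifact_mul B).
Proof.
move=> [x a] [y b] [z c]; rewrite /trifact_mul /=.
by rewrite lambdaD lambdaM baddA mulgA.
Qed.

Lemma trifact_mul1 (B : finSkewBraceType) :
  left_id (trifact_one B) (@trifact_mul B).
Proof.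
by move=> [x a]; rewrite /trifact_mul /= badd0b bzeroE lambda1 mul1g.
Qed.

Lemma trifact_mulV (B : finSkewBraceType) :
  left_inverse (trifact_one B) (@trifact_inv B) (@trifact_mul B).
Proof.
move=> [x a]; rewrite /trifact_mul /trifact_inv /trifact_one /=.
by rewrite -lambdaD baddNb lambda0 mulVg bzeroE.
Qed.

HB.instance Definition _ (B : finSkewBraceType) :=
  Finite_isGroup.Build (trifact B)
    (@trifact_mulA B) (@trifact_mul1 B) (@trifact_mulV B).

Definition embK (B : finSkewBraceType) (x : B) : trifact B := (x, 0%brace).
Definition embC (B : finSkewBraceType) (a : B) : trifact B := (0%brace, a).
Definition embD (B : finSkewBraceType) (b : B) : trifact B := (b, b).

Definition triK (B : finSkewBraceType) : {set trifact B} :=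
  [set embK x | x in [set: B]].
Definition triC (B : finSkewBraceType) : {set trifact B} :=
  [set embC a | a in [set: B]].
Definition triD (B : finSkewBraceType) : {set trifact B} :=
  [set embD b | b in [set: B]].

Lemma embKD (B : finSkewBraceType) :
  {morph @embK B : x y / (x + y)%brace >-> x * y}.
Proof.
move=> x y; rewrite [RHS]/(trifact_mul _ _) /trifact_mul /embK /=.
by rewrite bzeroE lambda1 mul1g.
Qed.

Lemma embCM (B : finSkewBraceType) : {morph @embC B : a b / a * b}.
Proof.
move=> a b; rewrite [RHS]/(trifact_mul _ _) /trifact_mul /embC /=.
by rewrite lambda0 badd0b.
Qed.

Lemma embDM (B : finSkewBraceType) : {morph @embD B : a b / a * b}.
Proof.
move=> a b; rewrite [RHS]/(trifact_mul _ _) /trifact_mul /embD /=.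
by rewrite /lambda !badd_mulg !bopp_invg mulKVg.
Qed.

Lemma triK_group_set (B : finSkewBraceType) : group_set (triK B).
Proof.
apply/group_setP; split; first by apply/imsetP; exists 0%brace; rewrite ?inE.
move=> _ _ /imsetP[x _ ->] /imsetP[y _ ->].
by rewrite -embKD imset_f ?inE.
Qed.
Canonical triK_group (B : finSkewBraceType) := Group (triK_group_set B).

Lemma triC_group_set (B : finSkewBraceType) : group_set (triC B).
Proof.
apply/group_setP; split; first by apply/imsetP; exists 0%brace; rewrite ?inE.
move=> _ _ /imsetP[x _ ->] /imsetP[y _ ->].
by rewrite -embCM imset_f ?inE.
Qed.
Canonical triC_group (B : finSkewBraceType) := Group (triC_group_set B).

Lemma triD_group_set (B : finSkewBraceType) : group_set (triD B).
Proof.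
apply/group_setP; split; first by apply/imsetP; exists 0%brace; rewrite ?inE.
move=> _ _ /imsetP[x _ ->] /imsetP[y _ ->].
by rewrite -embDM imset_f ?inE.
Qed.
Canonical triD_group (B : finSkewBraceType) := Group (triD_group_set B).

Definition is_subbrace (B : finSkewBraceType) (S : {set B}) : Prop :=
  group_set (S : {set addgroup B}) /\ group_set S.

(* Property D_pi. A nat_pred may also contain non-primes; these play no role  *)
(* in pi.-group and pi.-Hall.                                                 *)
Definition pi_Sylow_theorem (gT : finGroupType) (pi : nat_pred)
    (X : {group gT}) : Prop :=
  (forall P : {group gT}, P \subset X -> pi.-group P ->
     exists2 H : {group gT}, pi.-Hall(X) H & P \subset H) /\
  (forall H1 H2 : {group gT}, pi.-Hall(X) H1 -> pi.-Hall(X) H2 ->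
     exists2 x, x \in X & H2 = H1 :^ x :> {set gT}).

Definition compatible_Hall (B : finSkewBraceType) (pi : nat_pred)
    (Gp Kp Dp Cp : {group trifact B}) : Prop :=
  [/\ pi.-Hall([set: trifact B]) Gp,
      Kp = Gp :&: triK B :> {set trifact B},
      [/\ pi.-Hall(triK B) Kp, pi.-Hall(triD B) Dp & pi.-Hall(triC B) Cp]
    & [/\ Gp = Kp * Cp :> {set trifact B},
          Gp = Kp * Dp :> {set trifact B}
        & Gp = Dp * Cp :> {set trifact B}]].

(* Main.v *)
(** Existence is Wielandt's argument: if [H] and [H :^ x] are Hall subgroups of
    [G = D * C] that contain Hall subgroups of [D] and of [C] respectively, write
    [x = d * c]; then [H :^ d] contains Hall subgroups of both [D] and [C], and is
    their product by comparison of orders. The same comparison, applied to the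
    Hall subgroup [Kp = Gp :&: K] of the normal subgroup [K], gives the other two
    factorisations.
    Conversely, if [(x, 0)] is in [Kp], then [(x, 0) = (x, x) * (0, x^-1)] is its
    unique factorisation in [D * C], so [Gp = Dp * Cp] puts [x] in the subsets of
    [B] underlying [Dp] and [Cp]; the three subsets have the same cardinality
    [#|B|`_pi], hence coincide. *)

Require Import Defs.
From HB Require Import structures.
From mathcomp Require Import all_boot all_fingroup pgroup sylow.

Set Implicit Arguments.
Unset Strict Implicit.
Unset Printing Implicit Defensive.

Import GroupScope.

Lemma pi_Sylow_theorem_Hall (gT : finGroupType) (pi : nat_pred)
    (X : {group gT}) :
  pi_Sylow_theorem pi X -> exists H : {group gT}, pi.-Hall(X) H.
Proof.
by case=> exH _; have [H hallH _] := exH 1%G (sub1G X) (pgroup1 _ pi); exists H.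
Qed.

(** An order count: [#|X0| * #|Y0|] is the [pi]-part of [#|X| * #|Y|], that is of
    [#|G| * #|X :&: Y|]. Since [X0 :&: Y0] is a [pi]-group inside [X :&: Y], its order is at most
    the [pi]-part of [#|X :&: Y|], so [X0 * Y0] has at least [#|H|] elements. *)
Lemma Hall_mulG_eq (gT : finGroupType) (pi : nat_pred)
    (G X Y H X0 Y0 : {group gT}) :
  G = X * Y :> {set gT} -> pi.-Hall(G) H -> pi.-Hall(X) X0 -> pi.-Hall(Y) Y0 ->
  X0 \subset H -> Y0 \subset H -> H = X0 * Y0 :> {set gT}.
Proof.
move=> defG hallH hallX hallY sXH sYH; apply/esym/eqP.
rewrite eqEcard mul_subG //=.
have I0_gt0 : 0 < #|X0 :&: Y0| by rewrite cardG_gt0.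
rewrite -(leq_pmul2r I0_gt0) -mul_cardG (card_Hall hallX) (card_Hall hallY).
rewrite -partnM ?cardG_gt0 // mul_cardG -defG partnM ?cardG_gt0 //.
rewrite (card_Hall hallH) leq_pmul2l ?part_gt0 //.
have piI : pi.-group (X0 :&: Y0).
  exact: pgroupS (subsetIl _ _) (pHall_pgroup hallX).
rewrite -(part_pnat_id piI) dvdn_leq ?part_gt0 // partn_dvd ?cardG_gt0 //.
by rewrite cardSg ?setISS // (pHall_sub hallX, pHall_sub hallY).
Qed.

Lemma exists_Hall_mulG (gT : finGroupType) (pi : nat_pred)
    (G X Y : {group gT}) :
  G = X * Y :> {set gT} -> pi_Sylow_theorem pi G ->
  pi_Sylow_theorem pi X -> pi_Sylow_theorem pi Y ->
  exists H X0 Y0 : {group gT},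
    [/\ pi.-Hall(G) H, pi.-Hall(X) X0, pi.-Hall(Y) Y0,
        X0 \subset H & Y0 \subset H].
Proof.
move=> defG [exG conjG_] DpiX DpiY.
have [sXG sYG] : X \subset G /\ Y \subset G.
  by rewrite defG mulG_subl mulG_subr.
have [X0 hallX] := pi_Sylow_theorem_Hall DpiX.
have [Y0 hallY] := pi_Sylow_theorem_Hall DpiY.
have [H hallH sXH] :=
  exG X0 (subset_trans (pHall_sub hallX) sXG) (pHall_pgroup hallX).
have [H' hallH' sYH'] :=
  exG Y0 (subset_trans (pHall_sub hallY) sYG) (pHall_pgroup hallY).
have [g] := conjG_ _ _ hallH hallH'; rewrite {1}defG => /mulsgP[x y Xx Yy ->].
(* As [H'] is [H :^ (x * y)] and contains [Y0], undoing the conjugation by [y] places [Y0 :^ y^-1]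
   in [H :^ x]. Conjugating by [x] in [X] and [y^-1] in [Y] keeps the Hall property. *)
move=> defH'; exists (H :^ x)%G, (X0 :^ x)%G, (Y0 :^ y^-1)%G.
split=> /=.
- by rewrite pHallJ // (subsetP sXG).
- by rewrite pHallJ.
- by rewrite pHallJ ?groupV.
- by rewrite conjSg.
by rewrite sub_conjg invgK -conjsgM -defH'.
Qed.

Section TrifactorisedGroup.

Variable B : finSkewBraceType.
Implicit Types (x a b : B) (u v : trifact B).

Lemma trifact_mulE u v : u * v = ((u.1 + lambda u.2 v.1)%brace, u.2 * v.2).
Proof. by []. Qed.

Lemma baddb0 x : (x + 0)%brace = x.
Proof. by rewrite badd_mulg bzero_one mulg1. Qed.

Lemma embK_inj : injective (@embK B). Proof. by move=> x y []. Qed.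
Lemma embC_inj : injective (@embC B). Proof. by move=> x y []. Qed.
Lemma embD_inj : injective (@embD B). Proof. by move=> x y []. Qed.

Lemma embK_mul_embC x a : embK x * embC a = (x, a).
Proof. by rewrite trifact_mulE /= lambda0 baddb0 bzeroE mul1g. Qed.

Lemma embD_mul_embC b a : embD b * embC a = (b, b * a).
Proof. by rewrite trifact_mulE /= lambda0 baddb0. Qed.

Lemma embK_mul_embD x b : embK x * embD b = ((x + b)%brace, b).
Proof. by rewrite trifact_mulE /= bzeroE lambda1 mul1g. Qed.

(** The lambda action is conjugation by [C] on [K] inside the trifactorised group; this gives both
    the normality of [K] and the action of [Cp] on [Kp]. *)
Lemma embC_mul_embK a x : embC a * embK x = embK (lambda a x) * embC a.
Proof.
rewrite embK_mul_embC trifact_mulE /= badd0b [X in (_, X)](_ : _ = a) //.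
exact: mulb0.
Qed.

Lemma trifact_KC : [set: trifact B] = triK B * triC B.
Proof.
apply/esym/eqP; rewrite -subTset; apply/subsetP=> -[x a] _.
by rewrite -embK_mul_embC mem_mulg ?imset_f ?inE.
Qed.

Lemma trifact_KD : [set: trifact B] = triK B * triD B.
Proof.
apply/esym/eqP; rewrite -subTset; apply/subsetP=> -[x a] _.
have -> : (x, a) = embK (x + - a)%brace * embD a.
  by rewrite embK_mul_embD !badd_mulg bopp_invg mulgKV.
by rewrite mem_mulg ?imset_f ?inE.
Qed.

Lemma trifact_DC : [set: trifact B] = triD B * triC B.
Proof.
apply/esym/eqP; rewrite -subTset; apply/subsetP=> -[x a] _.
have -> : (x, a) = embD x * embC (x^-1 * a) by rewrite embD_mul_embC mulKVg.
by rewrite mem_mulg ?imset_f ?inE.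
Qed.

Lemma triK_normal : triK B <| [set: trifact B].
Proof.
rewrite /normal subsetT trifact_KC mul_subG ?normG //.
(* Passing to the inverse turns right conjugation into [embC a * _ * (embC a)^-1], which is
   [lambda a]. *)
apply/subsetP=> _ /imsetP[a _ ->]; rewrite -groupV inE.
apply/subsetP=> _ /imsetP[_ /imsetP[x _ ->] ->].
by rewrite conjgE invgK mulgA embC_mul_embK mulgK imset_f ?inE.
Qed.

Lemma mem_triK x : embK x \in triK B. Proof. by rewrite imset_f ?inE. Qed.

(** Makes Hall subgroups of different factors comparable as subsets of [B]: their common size turns
    inclusions into equalities. *)
Lemma card_preim_emb_Hall (pi : nat_pred) (f : B -> trifact B)
    (H X : {group trifact B}) :
    injective f -> X = [set f x | x in [set: B]] :> {set trifact B} ->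
    pi.-Hall(X) H ->
  #|f @^-1: H| = (#|[set: B]|`_pi)%N.
Proof.
move=> f_inj defX hallH; rewrite -(card_imset [set: B] f_inj) -defX.
rewrite -(card_Hall hallH) -(card_imset _ f_inj); apply: eq_card => u.
apply/imsetP/idP => [[x]|Hu]; first by rewrite inE => ? ->.
have /imsetP[x _ def_u] : u \in [set f x | x in [set: B]].
  by rewrite -defX (subsetP (pHall_sub hallH)).
by exists x; rewrite // inE -def_u.
Qed.

End TrifactorisedGroup.

Theorem mainTheorem2 (B : finSkewBraceType) (pi : nat_pred)
    (DpiG : pi_Sylow_theorem pi [set: trifact B]%G)
    (DpiD : pi_Sylow_theorem pi (triD_group B))
    (DpiC : pi_Sylow_theorem pi (triC_group B)) :
  (exists Gp Kp Dp Cp : {group trifact B}, compatible_Hall pi Gp Kp Dp Cp) /\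
  (forall Gp Kp Dp Cp : {group trifact B}, compatible_Hall pi Gp Kp Dp Cp ->
     let KpB : {set B} := @embK B @^-1: Kp in
     let CpB : {set B} := @embC B @^-1: Cp in
     [/\ forall a, a \in CpB -> lambda a @: KpB = KpB,
         KpB = CpB,
         Dp = [set embD b | b in KpB] :> {set trifact B}
       & is_subbrace KpB]).
Proof.
split.
  have [Gp [Dp [Cp [hallG hallD hallC sDG sCG]]]] :=
    exists_Hall_mulG (trifact_DC B) DpiG DpiD DpiC.
  have hallK : pi.-Hall(triK B) (Gp :&: triK_group B).
    by apply: (Hall_setI_normal (triK_normal B) hallG).
  exists Gp, (Gp :&: triK_group B)%G, Dp, Cp; split=> //; split.
  - exact: Hall_mulG_eq (trifact_KC B) hallG hallK hallC (subsetIl _ _) sCG.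
  - exact: Hall_mulG_eq (trifact_KD B) hallG hallK hallD (subsetIl _ _) sDG.
  - exact: Hall_mulG_eq (trifact_DC B) hallG hallD hallC sDG sCG.
move=> Gp Kp Dp Cp [hallG defK [hallK hallD hallC] [GKC GKD GDC]] KpB CpB.
have cardK : #|KpB| = (#|[set: B]|`_pi)%N.
  exact: (card_preim_emb_Hall (X := triK_group B) (@embK_inj B) erefl hallK).
have cardC : #|CpB| = (#|[set: B]|`_pi)%N.
  exact: (card_preim_emb_Hall (X := triC_group B) (@embC_inj B) erefl hallC).
have cardD : #|Dp| = (#|[set: B]|`_pi)%N.
  by rewrite (card_Hall hallD) card_imset //; apply: embD_inj.
have sKG : Kp \subset Gp by rewrite GKC mulG_subl.
have sCG : Cp \subset Gp by rewrite GKC mulG_subr.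
have KDC x : x \in KpB -> embD x \in Dp /\ x \in CpB.
  rewrite inE => Kx; have := subsetP sKG _ Kx.
  rewrite GDC => /mulsgP[u v Du Cv].
  have /imsetP[b _ def_u] := subsetP (pHall_sub hallD) _ Du.
  have /imsetP[a _ def_v] := subsetP (pHall_sub hallC) _ Cv.
  rewrite def_u def_v embD_mul_embC => -[-> ba1]; rewrite -def_u inE.
  (* Second components give [b * a = 0], the identity, so [embC b] is the inverse of an element of
     [Cp]. *)
  split=> //; have -> : b = a^-1 by apply/eqP; rewrite eq_mulgV1 invgK -ba1 -bzeroE.
  have -> : embC a^-1 = (embC a)^-1.
    by apply/eqP; rewrite eq_mulgV1 invgK -embCM mulVg -bzeroE.
  by rewrite groupV -def_v.
have eqKC : KpB = CpB.
  apply/eqP; rewrite eqEcard cardK cardC leqnn andbT.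
  by apply/subsetP=> x /KDC[].
(* [Kp] is the intersection of [Gp] with [K], hence stable under conjugation by elements of [Cp],
   which lie in [Gp]. *)
have lamK a x : a \in CpB -> x \in KpB -> lambda a x \in KpB.
  rewrite !inE => Ca Kx; rewrite defK inE mem_triK andbT.
  have -> : embK (lambda a x) = embC a * embK x * (embC a)^-1.
    by rewrite embC_mul_embK mulgK.
  by rewrite !groupM ?groupV ?(subsetP sCG _ Ca) ?(subsetP sKG _ Kx).
split=> //.
- move=> a Ca; apply/eqP; rewrite eqEcard card_imset; last first.
    apply: (can_inj (g := lambda a^-1)) => x.
    by rewrite -lambdaM mulVg lambda1.
  by rewrite leqnn andbT; apply/subsetP=> _ /imsetP[x Kx ->]; apply: lamK.
- apply/eqP; rewrite eq_sym eqEcard cardD card_imset; last exact: embD_inj.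
  by rewrite cardK leqnn andbT; apply/subsetP=> _ /imsetP[x /KDC[Dx _] ->].
split.
  apply/group_setP; split=> [|x y]; first by rewrite inE; apply: (group1 Kp).
  by rewrite !inE => Kx Ky; rewrite [embK _]embKD groupM.
(* Additive closure came from [Kp] through [embK]; multiplicative closure comes from [Cp] through
   [embC], the two subsets being equal. *)
rewrite eqKC; apply/group_setP; split=> [|a b].
  by rewrite inE -bzeroE; apply: (group1 Cp).
by rewrite !inE => Ca Cb; rewrite embCM groupM.
Qed.
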